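(* Let $P$ and $Q$ be probability distributions on $\mathsf Z$, and let $a_P,a_Q\in\mathsf A$ satisfy $H_\ell(P)=\mathbb E_P[\ell(Z,a_P)]$ and $H_\ell(Q)=\mathbb E_Q[\ell(Z,a_Q)]$. For $a\in\mathsf A$ let $P_{\ell(Z,a)}$ and $Q_{\ell(Z,a)}$ denote the distributions on $\mathbb R$ of the random variable $\ell(Z,a)$ when $Z\sim P$ and when $Z\sim Q$, respectively. Then: (1) If $\ell(z,a_Q)\in[\alpha_Q,\beta_Q]$ for all $z\in\mathsf Z$, then $H_\ell(P)-H_\ell(Q)\le(\beta_Q-\alpha_Q)\,d_{\rm TV}(P_{\ell(Z,a_Q)},Q_{\ell(Z,a_Q)})$. If $\ell(z,a_P)\in[\alpha_P,\beta_P]$ for all $z\in\mathsf Z$, then $H_\ell(Q)-H_\ell(P)\le(\beta_P-\alpha_P)\,d_{\rm TV}(P_{\ell(Z,a_P)},Q_{\ell(Z,a_P)})$. (2) If $\ell(Z,a_Q)$ is $\sigma_Q^2$-subgaussian under $Q$, then $H_\ell(P)-H_\ell(Q)\le\sqrt{2\sigma_Q^2D(P_{\ell(Z,a_Q)}\|Q_{\ell(Z,a_Q)})}$. If $\ell(Z,a_P)$ is $\sigma_P^2$-subgaussian under $Q$, then $H_\ell(Q)-H_\ell(P)\le\sqrt{2\sigma_P^2D(P_{\ell(Z,a_P)}\|Q_{\ell(Z,a_P)})}$. More generally, if $\varphi_Q:[0,b_Q)\to\mathbb R$ with $b_Q\in(0,\infty]$ satisfies $\log\mathbb E_Q[e^{\lambda(\ell(Z,a_Q)-\mathbb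 E_Q[\ell(Z,a_Q)])}]\le\varphi_Q(\lambda)$ for all $0\le\lambda<b_Q$, then $H_\ell(P)-H_\ell(Q)\le\varphi_Q^{*-1}\big(D(P_{\ell(Z,a_Q)}\|Q_{\ell(Z,a_Q)})\big)$; and if $\varphi_P:[0,b_P)\to\mathbb R$ with $b_P\in(0,\infty]$ satisfies $\log\mathbb E_Q[e^{-\lambda(\ell(Z,a_P)-\mathbb E_Q[\ell(Z,a_P)])}]\le\varphi_P(\lambda)$ for all $0\le\lambda<b_P$, then $H_\ell(Q)-H_\ell(P)\le\varphi_P^{*-1}\big(D(P_{\ell(Z,a_P)}\|Q_{\ell(Z,a_P)})\big)$. (3) If $\mathsf Z=\mathsf A=\mathbb R$, $\ell(z,a)=(z-a)^2$ (so $H_\ell$ is the variance, $a_P=\mathbb E_P[Z]$, $a_Q=\mathbb E_Q[Z]$), and $Q$ is Gaussian with variance $\sigma^2$ and arbitrary mean, then, with $D_Q=D(P_{\ell(Z,a_Q)}\|Q_{\ell(Z,a_Q)})$ and $D_P=D(P_{\ell(Z,a_P)}\|Q_{\ell(Z,a_P)})$, $\mathrm{Var}_P[Z]-\mathrm{Var}_Q[Z]\le2\sigma^2(\sqrt{D_Q}+D_Q)$ and $\mathrm{Var}_Q[Z]-\mathrm{Var}_P[Z]\le2\sigma^2(\sqrt{D_P}+D_P)$. (4) If $\mathrm{Var}_Q[\ell(Z,a_Q)]$ and $\mathrm{Var}_Q[\ell(Z,a_P)]$ exist, then $H_\ell(P)-H_\ell(Q)\le\sqrt{\mathrm{Var}_Q[\ell(Z,a_Q)]\,\chi^2(P_{\ell(Z,a_Q)}\|Q_{\ell(Z,a_Q)})}$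 and $H_\ell(Q)-H_\ell(P)\le\sqrt{\mathrm{Var}_Q[\ell(Z,a_P)]\,\chi^2(P_{\ell(Z,a_P)}\|Q_{\ell(Z,a_P)})}$.
   Context: $\mathsf Z$ is a (measurable) space of outcomes, $\mathsf A$ a space of actions, $\ell:\mathsf Z\times\mathsf A\to\mathbb R$ a loss function. The generalized entropy of a distribution $P$ on $\mathsf Z$ is $H_\ell(P)=\inf_{a\in\mathsf A}\mathbb E_P[\ell(Z,a)]$, $Z\sim P$. It is assumed that the infimum is attained for the distributions considered, and that the expectations appearing are well defined. $d_{\rm TV}(P,Q)=\frac12\int|P-Q|(\mathrm dz)$; $D(\cdot\|\cdot)$ is the KL divergence (natural logarithm; bounds are trivial when it is infinite); $\chi^2(P\|Q)=\mathbb E_Q[(\frac{\mathrm dP}{\mathrm dQ}-1)^2]$ (with $P$ absolutely continuous with respect to $Q$). $U$ is $\sigma^2$-subgaussian if $\mathbb E[e^{\lambda(U-\mathbb EU)}]\le e^{\lambda^2\sigma^2/2}$ for all $\lambda\in\mathbb R$. For a function $\varphi$ on $[0,b)$, $\varphi^*(\gamma)=\sup_{0\le\lambda<b}(\lambda\gamma-\varphi(\lambda))$ for $\gamma\in\mathbb R$ and $\varphi^{*-1}(x)=\sup\{\gamma\in\mathbb R:\varphi^*(\gamma)\le x\}$ for $x\in\mathbb R$. *)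

(* Defs.v *)
From HB Require Import structures.
From mathcomp Require Import all_boot all_order all_algebra.
From mathcomp Require Import all_classical all_reals all_analysis.
From mathcomp Require Import measurable_realfun.
Set Implicit Arguments.
Unset Strict Implicit.
Unset Printing Implicit Defensive.
Import Order.TTheory GRing.Theory Num.Theory.
Import numFieldNormedType.Exports.
Local Open Scope classical_set_scope.
Local Open Scope ring_scope.
Local Open Scope ereal_scope.
Local Open Scope charge_scope.

Section divergences.
Context d (T : measurableType d) (R : realType).
Implicit Types P Q : probability T R.

Definition charge_diff P Q : {charge set T -> \bar R} :=
  cadd (charge_of_finite_measure P) (copp (charge_of_finite_measure Q)).

(* The value does not depend on the Hahn decomposition that is chosen, see
   Hahn_decomposition_uniq. *)
Definition total_variation_measure (nu : {charge set T -> \bar R}) :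
    set T -> \bar R :=
  charge_variation (projT2 (cid (projT2 (cid (Hahn_decomposition nu))))).

Definition dTV P Q : \bar R :=
  (2^-1)%:E * total_variation_measure (charge_diff P Q) [set: T].

(* The Radon-Nikodym derivative is positive P-almost everywhere, so the value
   -oo that lne takes at 0 does not contribute to the integral. *)
Definition KL P Q : \bar R :=
  if `[< P `<< Q >]
  then \int[P]_x lne (('d (charge_of_finite_measure P) '/d Q) x)
  else +oo.

Definition chi2 P Q : \bar R :=
  if `[< P `<< Q >]
  then \int[Q]_x ((('d (charge_of_finite_measure P) '/d Q) x - 1) ^+ 2)
  else +oo.

End divergences.

(* A bound f(D) in terms of a divergence D is +oo, hence trivial, when D is
   infinite. With the library's convention 0 * +oo = 0, an expression such as
   sqrt (2 * sigma ^+ 2 * D) would instead be 0 for sigma = 0 and D = +oo.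
   The value D = -oo does not occur. *)
Definition bound_at (R : realType) (f : R -> \bar R) (D : \bar R) : \bar R :=
  if D is r%:E then f r else +oo.

Section random_variables.
Context d (T : measurableType d) (R : realType).
Implicit Types (P : probability T R) (U : T -> R).

(* 'E_P[U] = E[U^+] - E[U^-] is not of the form oo - oo. *)
Definition expectation_defined P U : Prop :=
  \int[P]_x ((EFin \o U)^\+ x) +? - \int[P]_x ((EFin \o U)^\- x).

Definition centered P U : T -> R := fun x => (U x - fine 'E_P[U])%R.

Definition subgaussian P U (v : R) : Prop :=
  P.-integrable [set: T] (EFin \o U) /\
  forall lambda : R,
    'M_P (centered P U) lambda <= (expR (lambda ^+ 2 * v / 2))%:E.

End random_variables.

(* The loss of action a at outcome z is ell a z; the argument order records that
   z |-> ell a z is measurable for every a. *)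
Definition gen_entropy d (Z : measurableType d) (R : realType) (A : Type)
    (ell : A -> {mfun Z >-> R}) (P : probability Z R) : \bar R :=
  ereal_inf [set 'E_P[ell a] | a in [set: A]].

Section conjugate.
Context (R : realType).
Implicit Types (b : \bar R) (phi : R -> R).

(* Only the values of phi on [0, b) matter. *)
Definition conjugate b phi (gamma : R) : \bar R :=
  ereal_sup [set (lambda * gamma - phi lambda)%:E
            | lambda in [set lambda : R | (0 <= lambda)%R /\ lambda%:E < b]].

Definition conjugate_inv b phi (x : R) : \bar R :=
  ereal_sup [set gamma%:E | gamma in [set gamma | conjugate b phi gamma <= x%:E]].

End conjugate.

Section quadratic_loss.
Context (R : realType).

Definition sqloss (a : R) (z : measurableTypeR R) : R := ((z - a) ^+ 2)%R.

Lemma measurable_sqloss a : measurable_fun [set: measurableTypeR R] (sqloss a).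
Proof. by apply: measurable_funX; exact: measurable_funB. Qed.

HB.instance Definition _ (a : R) :=
  isMeasurableFun.Build _ _ _ _ (sqloss a) (measurable_sqloss a).

Definition quadratic_loss (a : R) : {mfun measurableTypeR R >-> R} := sqloss a.

End quadratic_loss.

(* Main.v *)
(* H(P) - H(Q) <= E_P[l(Z, a_Q)] - E_Q[l(Z, a_Q)] since a_Q is only suboptimal
   for P, and symmetrically with a_P, so each claim bounds E_P[U] - E_Q[U] for
   the laws of U on the real line. For (1), a Hahn decomposition splits U. For
   (2), the Donsker-Varadhan inequality gives
   lambda (E_P[U] - E_Q[U]) <= D + phi(lambda) for 0 <= lambda < b, which is the
   definition of the inverse conjugate; for (4), the same inequality holds with
   D replaced by chi2 / 2 and phi(lambda) = lambda^2 Var / 2. For (3), the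
   exponential moments of (Z - a)^2 under a Gaussian are explicit; when a = a_P
   is not the mean of Q the noncentrality only helps, because Var_Q, and not
   E_Q[(Z - a_P)^2], has to be compared with Var_P. *)
Require Import Defs.
From mathcomp Require Import all_boot all_order all_algebra.
From mathcomp Require Import all_classical all_reals all_analysis.
From mathcomp Require Import measurable_realfun ring lra.
Set Implicit Arguments.
Unset Strict Implicit.
Unset Printing Implicit Defensive.
Import Order.TTheory GRing.Theory Num.Theory.
Import numFieldNormedType.Exports.
Local Open Scope classical_set_scope.
Local Open Scope ring_scope.
Local Open Scope ereal_scope.

(** So the Donsker-Varadhan step also bounds the integral of the positive part, which excludes +oo;
    the value -oo makes an upper bound trivial, and only in the remaining case are integrals linear.
    The two halves of (3) have different shapes. With s = 2 lambda sigma^2, the upper tail of (Z -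
    m)^2 has log-moment at most s^2 / (4 (1 - s)), for s < 1 only, and the inverse conjugate yields
    2 sigma^2 (sqrt D + D); the lower tail has log-moment at most s^2 / 4, which yields 2 sigma^2
    sqrt D. A single Gaussian integral is computed, that of exp (a u^2 + b u). The mean and variance
    of the Gaussian are read off from it, because a variable whose exponential moments are at most
    exp (C t^2) for all small t of both signs has mean zero. *)

(** * Integrals of real-valued functions and under image laws *)

Section integral_bounds.
Context {d : measure_display} {T : measurableType d} {R : realType}.
Implicit Types (mu : {measure set T -> \bar R}) (f g h : T -> R).

(* No integrability is needed: when both the positive and the negative part have
   infinite integral, the integral is oo - oo = -oo. *)
Lemma ae_le_integralT mu f g : measurable_fun [set: T] f ->
  measurable_fun [set: T] g -> {ae mu, forall x, (f x <= g x)%R} ->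
  \int[mu]_x (f x)%:E <= \int[mu]_x (g x)%:E.
Proof.
move=> /measurable_EFinP mf /measurable_EFinP mg fg.
rewrite integralE [leRHS]integralE; apply: leeB.
- apply: ae_ge0_le_integral => //; first exact: measurable_funepos.
    exact: measurable_funepos.
  apply: filterS fg => x fg _; rewrite !funeposE.
  by rewrite ge_max !le_max lexx orbT lee_fin fg.
- apply: ae_ge0_le_integral => //; first exact: measurable_funeneg.
    exact: measurable_funeneg.
  apply: filterS fg => x fg _; rewrite !funenegE.
  by rewrite ge_max !le_max lexx orbT -!EFinN lee_fin lerN2 fg.
Qed.

Lemma integral_fin_num_integrable mu f : measurable_fun [set: T] f ->
  \int[mu]_x (f x)%:E \is a fin_num -> mu.-integrable [set: T] (EFin \o f).
Proof.
move=> mf fin; apply/integrableP; split; first exact/measurable_EFinP.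
by move: fin; rewrite -(integral_fin_num_abs mu measurableT).
Qed.

Lemma ge0_integrable_lty mu f : measurable_fun [set: T] f ->
  (forall x, 0 <= f x)%R -> \int[mu]_x (f x)%:E < +oo ->
  mu.-integrable [set: T] (EFin \o f).
Proof.
move=> mf f0 foo; apply: integral_fin_num_integrable => //.
by rewrite ge0_fin_numE// integral_ge0// => x _; rewrite lee_fin.
Qed.

Lemma le_integrableR mu f g : measurable_fun [set: T] f ->
  (forall x, `|f x| <= g x)%R -> mu.-integrable [set: T] (EFin \o g) ->
  mu.-integrable [set: T] (EFin \o f).
Proof.
move=> mf fg; apply: le_integrable => //; first exact/measurable_EFinP.
by move=> x _ /=; rewrite lee_fin (le_trans (fg x))// ler_norm.
Qed.

Lemma integrableDR mu f g : mu.-integrable [set: T] (EFin \o f) ->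
  mu.-integrable [set: T] (EFin \o g) ->
  mu.-integrable [set: T] (EFin \o (fun x => f x + g x)%R).
Proof. by move=> intf intg; exact: (integrableD measurableT intf intg). Qed.

Lemma integrableZR mu f (k : R) : mu.-integrable [set: T] (EFin \o f) ->
  mu.-integrable [set: T] (EFin \o (fun x => k * f x)%R).
Proof. by move=> intf; exact: (integrableZl measurableT k intf). Qed.

Lemma integrable_cstR (P : probability T R) (k : R) :
  P.-integrable [set: T] (EFin \o (fun=> k)).
Proof. exact: finite_measure_integrable_cst. Qed.

Lemma integralDR mu f g : mu.-integrable [set: T] (EFin \o f) ->
  mu.-integrable [set: T] (EFin \o g) ->
  \int[mu]_x (f x + g x)%:E = \int[mu]_x (f x)%:E + \int[mu]_x (g x)%:E.
Proof. by move=> intf intg; rewrite -integralD_EFin. Qed.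

Lemma integralZR mu f (k : R) : mu.-integrable [set: T] (EFin \o f) ->
  \int[mu]_x (k * f x)%:E = k%:E * \int[mu]_x (f x)%:E.
Proof. by move=> intf; rewrite -(integralZl measurableT intf). Qed.

Lemma integral_cstR (P : probability T R) (k : R) : \int[P]_x k%:E = k%:E.
Proof. by rewrite integral_cst// [X in _ * X]probability_setT mule1. Qed.

Lemma integral_funpos_lty mu f g : measurable_fun [set: T] f ->
  mu.-integrable [set: T] (EFin \o g) ->
  {ae mu, forall x, (f x <= g x)%R} ->
  \int[mu]_x (Num.max (f x) 0)%:E < +oo.
Proof.
move=> mf intg fg; have mg : measurable_fun [set: T] g.
  by apply/measurable_EFinP; exact: measurable_int intg.
have /(integrable_lty measurableT) :
    mu.-integrable [set: T] (EFin \o (fun x => `|g x|)%R).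
  exact: integrable_norm.
apply: le_lt_trans => //; apply: ae_le_integralT.
- exact: measurable_maxr.
- exact: measurableT_comp.
- apply: filterS fg => x fg; rewrite ge_max normr_ge0 andbT.
  exact: le_trans fg (ler_norm _).
Qed.

End integral_bounds.

Section integral_distribution.
Context {d d' : measure_display} {T : measurableType d} {T' : measurableType d'}
  {R : realType}.
Implicit Types (P : probability T R).

Lemma integral_distributionE P (X : {mfun T >-> T'}) (h : T' -> R) :
  measurable_fun [set: T'] h ->
  \int[distribution P X]_y (h y)%:E = \int[P]_x (h (X x))%:E.
Proof.
move=> /measurable_EFinP mh; rewrite integralE [RHS]integralE; congr (_ - _).
- rewrite (@ge0_integral_distribution _ _ _ _ _ P X)//; last exact: measurable_funepos.
  by apply: eq_integral => x _; rewrite /= !funeposE.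
- rewrite (@ge0_integral_distribution _ _ _ _ _ P X)//; last exact: measurable_funeneg.
  by apply: eq_integral => x _; rewrite /= !funenegE.
Qed.

End integral_distribution.

(** * Change of measure *)

Section density.
Context {d : measure_display} {T : measurableType d} {R : realType}.
Implicit Types (P Q : probability T R).

(** A real-valued, everywhere nonnegative version of dP/dQ. The third clause ties it to the
    derivative in [KL] and [chi2]; the last one is the change of measure for nonnegative integrands,
    infinite integrals included. *)
Definition is_density P Q (f : T -> R) :=
  [/\ measurable_fun [set: T] f, (forall x, 0 <= f x)%R,
      {ae Q, forall x,
        Radon_Nikodym (charge_of_finite_measure P) Q x = (f x)%:E} &
      forall g : T -> R, measurable_fun [set: T] g -> (forall x, 0 <= g x)%R ->
        \int[P]_x (g x)%:E = \int[Q]_x (g x * f x)%:E].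

Lemma density_exists P Q : P `<< Q -> exists f, is_density P Q f.
Proof.
move=> PQ; pose F := Radon_Nikodym_SigmaFinite.f P Q.
have Ffin x : F x \is a fin_num by exact: Radon_Nikodym_SigmaFinite.f_fin_num.
have mF : measurable_fun [set: T] F.
  exact: measurable_int (Radon_Nikodym_SigmaFinite.f_integrable PQ).
exists (fine \o F); split.
- exact: measurableT_comp.
- by move=> x /=; apply: fine_ge0; exact: Radon_Nikodym_SigmaFinite.f_ge0.
- have := ae_eq_Radon_Nikodym_SigmaFinite PQ measurableT.
  by apply: filterS => x /(_ I) <-; rewrite /= fineK.
- move=> g mg g0.
  rewrite -(@Radon_Nikodym_SigmaFinite.change_of_variables _ _ _ P Q PQ)//.
  + by apply: eq_integral => x _; rewrite EFinM/= fineK.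
  + exact/measurable_EFinP.
Qed.

Lemma Radon_Nikodym_EFin P Q : P `<< Q ->
  exists2 g : T -> R, measurable_fun [set: T] g &
    Radon_Nikodym (charge_of_finite_measure P) Q = EFin \o g.
Proof.
move=> PQ; exists (fine \o Radon_Nikodym (charge_of_finite_measure P) Q).
  by apply: measurableT_comp => //.
by apply/funext => x /=; rewrite fineK// Radon_Nikodym_fin_num.
Qed.

Lemma null_dominates_ae P Q (p : T -> Prop) : P `<< Q ->
  {ae Q, forall x, p x} -> {ae P, forall x, p x}.
Proof.
move=> /null_content_dominatesP PQ [A [mA A0 pA]]; exists A; split => //.
exact: PQ.
Qed.

(** By change of measure, P(f = 0) is the Q-integral of f over the set f = 0. *)
Lemma density_gt0 P Q f : is_density P Q f -> {ae P, forall x, (0 < f x)%R}.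
Proof.
move=> [mf f0 _ ch].
have mA : measurable (f @^-1` [set 0%R]).
  by rewrite -[X in measurable X]setTI; exact: mf.
exists (f @^-1` [set 0%R]); split => //; last first.
  move=> x /=; rewrite lt_neqAle f0 andbT => /negP/negPn/eqP ->//.
rewrite -[X in P X]setIT -integral_indic// ch//; last first.
rewrite (eq_integral (cst 0)) ?integral0// => x _ /=.
rewrite indicE; case: (boolP (x \in _)) => [|_]; last by rewrite mul0r.
by rewrite inE /= => ->; rewrite mulr0.
Qed.

(* The pointwise inequality y <= ln f + exp y / f - 1, integrated against P. *)
Lemma Donsker_Varadhan P Q (h : T -> R) (c r : R) : measurable_fun [set: T] h ->
  \int[Q]_x (expR (h x))%:E <= (expR c)%:E -> KL P Q = r%:E ->
  \int[P]_x (Num.max (h x) 0)%:E < +oo /\ \int[P]_x (h x)%:E <= (r + c)%:E.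
Proof.
move=> mh hc; rewrite /KL; case: asboolP => // PQ KLr.
have [f fP] := density_exists PQ; have [mf f0 fRN ch] := fP.
have fgt0 := density_gt0 fP.
have mln : measurable_fun [set: T] (fun x => ln (f x)).
  exact: measurableT_comp.
have lnr : \int[P]_x (ln (f x))%:E = r%:E.
  rewrite -KLr; apply: ae_eq_integral => //.
  - exact/measurable_EFinP.
  - have [g mg ->] := Radon_Nikodym_EFin PQ.
    apply: measurable_fun_ifT => //; first exact: measurable_fun_ler.
    by apply/measurable_EFinP; exact: measurableT_comp.
  - move: (null_dominates_ae PQ fRN); apply: filterS2 fgt0 => x fx -> _.
    by rewrite lne_EFin.
have intln : P.-integrable [set: T] (EFin \o (fun x => ln (f x))).
  by apply: integral_fin_num_integrable => //; rewrite lnr.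
(* Where f > 0, [k] is exp (h - c) / f. Hence k f <= exp (h - c) everywhere, the left side being 0
   where f = 0, and the change of measure makes the P-integral of [k] at most 1. *)
pose k x := expR (h x - c - ln (f x)).
have k0 x : (0 <= k x)%R by exact: expR_ge0.
have mk : measurable_fun [set: T] k.
  by apply: measurableT_comp => //; apply: measurable_funB => //;
     exact: measurable_funB.
have k1 : \int[P]_x (k x)%:E <= 1.
  rewrite ch//; apply: (@le_trans _ _ (\int[Q]_x (expR (- c) * expR (h x))%:E)).
    apply: ge0_le_integral => //.
    - by move=> x _; rewrite lee_fin mulr_ge0.
    - by apply/measurable_EFinP; exact: measurable_funM.
    - apply/measurable_EFinP; apply: measurable_funM => //.
      exact: measurableT_comp.
    - move=> x _; rewrite lee_fin /k -expRD [(- c + _)%R]addrC.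
      have := f0 x; rewrite le_eqVlt => /predU1P[<-|fx].
        by rewrite mulr0 expR_ge0.
      by rewrite expRB lnK ?posrE// divfK ?gt_eqF.
  under eq_integral do rewrite EFinM.
  rewrite ge0_integralZl//; last first.
    by apply/measurable_EFinP; exact: measurableT_comp.
  rewrite -[leRHS](_ : (expR (- c))%:E * (expR c)%:E = 1); last first.
    by rewrite -EFinM -expRD addNr expR0.
  by rewrite lee_pmul2l// lte_fin expR_gt0.
have intk : P.-integrable [set: T] (EFin \o k).
  by apply: ge0_integrable_lty => //; apply: le_lt_trans k1 _; rewrite ltry.
pose g x := (ln (f x) + (k x + (c - 1)))%R.
have intg : P.-integrable [set: T] (EFin \o g).
  do 2 apply: integrableDR => //; exact: integrable_cstR.
have hg : {ae P, forall x, (h x <= g x)%R}.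
  apply: filterS fgt0 => x fx.
  have := expR_ge1Dx (h x - c - ln (f x)); rewrite -/(k x) /g; lra.
have mg : measurable_fun [set: T] g.
  by apply/measurable_EFinP; exact: measurable_int intg.
split; first exact: integral_funpos_lty hg.
apply: (le_trans (ae_le_integralT mh mg hg)).
rewrite integralDR//; last by apply: integrableDR => //; exact: integrable_cstR.
rewrite lnr integralDR//; last exact: integrable_cstR.
rewrite integral_cstR [leRHS]EFinD; apply: leeD2l.
rewrite -[leRHS](_ : 1 + (c - 1)%:E = c%:E); last by rewrite -EFinD addrC subrK.
exact: leeD2r.
Qed.

End density.

(** * The inverse conjugate *)

Section conjugate_inverse.
Context {R : realType}.
Implicit Types (b : \bar R) (phi : R -> R).

Lemma conjugate_inv_ge b phi (r g : R) :
  (forall l : R, (0 <= l)%R -> l%:E < b -> (l * g <= r + phi l)%R) ->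
  g%:E <= conjugate_inv b phi r.
Proof.
move=> H; apply: ereal_sup_ubound; exists g => //=.
apply: ge_ereal_sup => _ [l [l0 lb] <-]; rewrite lee_fin lerBlDr.
exact: H.
Qed.

Lemma conjugate_inv_le b phi (r y : R) :
  (forall g : R, (forall l : R, (0 <= l)%R -> l%:E < b ->
     (l * g <= r + phi l)%R) -> (g <= y)%R) ->
  conjugate_inv b phi r <= y%:E.
Proof.
move=> H; apply: ge_ereal_sup => _ [g gr <-]; rewrite lee_fin.
apply: H => l l0 lb; rewrite -lerBlDr -lee_fin.
by apply: le_trans gr; apply: ereal_sup_ubound; exists l.
Qed.

(** For g > 0 and v > 0 the best multiplier is l = g / v, which turns l g <= r + l^2 v / 2 into g^2
    <= 2 v r. *)
Lemma conjugate_inv_quadratic (v r : R) : (0 <= v)%R ->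
  conjugate_inv +oo (fun l => l ^+ 2 * v / 2)%R r <= (Num.sqrt (2 * v * r))%:E.
Proof.
move=> v0; apply: conjugate_inv_le => g H.
have {}H l : (0 <= l)%R -> (l * g <= r + l ^+ 2 * v / 2)%R.
  by move=> l0; apply: H => //; rewrite ltry.
have [g0|g0] := leP g 0%R; first exact: le_trans g0 (sqrtr_ge0 _).
move: v0; rewrite le_eqVlt => /predU1P[v0|v0].
  have r0 : (0 <= r)%R by have := H 0%R (lexx _); rewrite !mul0r expr0n/=; lra.
  (* With v = 0 the constraint reads l g <= r for all l >= 0; this l violates it. *)
  have := H ((r + 1) / g)%R; rewrite -v0 divfK ?gt_eqF//.
  have l0 : (0 <= (r + 1) / g)%R by rewrite divr_ge0 ?ltW//; lra.
  by move=> /(_ l0); lra.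
have := H (g / v)%R (divr_ge0 (ltW g0) (ltW v0)).
have -> : (g / v * g = g ^+ 2 / v)%R by rewrite mulrAC expr2.
have -> : ((g / v) ^+ 2 * v / 2 = g ^+ 2 / v / 2)%R by field; rewrite gt_eqF.
move=> gr; have {}gr : (g ^+ 2 / v <= 2 * r)%R by lra.
have := gr; rewrite ler_pdivrMr// mulrAC => {}gr.
by rewrite -[leLHS]gtr0_norm// -sqrtr_sqr ler_wsqrtr.
Qed.

End conjugate_inverse.

(** * From divergences to gaps of expectations *)

Section expectation_gap.
Context {d : measure_display} {T : measurableType d} {R : realType}.
Implicit Types (P Q : probability T R) (v : T -> R).

(** Common end of the KL and chi-square arguments. The first bound, at a single l > 0, shows that
    the integral of [v] is not +oo; once it is finite, the second bound is exactly the constraint in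
    the inverse conjugate. *)
Lemma expectation_gap_le P v (m r : R) (b : \bar R) (phi : R -> R) :
  measurable_fun [set: T] v -> 0 < b ->
  (forall l : R, (0 <= l)%R -> l%:E < b ->
    \int[P]_x (Num.max (l * (v x - m)) 0)%:E < +oo /\
    \int[P]_x (l * (v x - m))%:E <= (r + phi l)%:E) ->
  \int[P]_x (v x)%:E - m%:E <= conjugate_inv b phi r.
Proof.
move=> mv b0 H.
have mvm l : measurable_fun [set: T] (fun x => l * (v x - m))%R.
  by apply: measurable_funM => //; exact: measurable_funB.
have [l l0 lb] : exists2 l : R, (0 < l)%R & l%:E < b.
  case: b b0 {H} => [b| |]// b0.
    exists (b / 2)%R; first by rewrite divr_gt0.
    by rewrite lte_fin ltr_pdivrMr// mulr2n mulrDr mulr1 ltrDl.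
  by exists 1%R => //; rewrite ltry.
have vfin : \int[P]_x (v x)%:E < +oo.
  have [maxfin _] := H l (ltW l0) lb.
  have intmax : P.-integrable [set: T]
      (EFin \o (fun x => Num.max (l * (v x - m)) 0)%R).
    apply: ge0_integrable_lty => //; first exact: measurable_maxr.
    by move=> x; rewrite le_max lexx orbT.
  pose g x := (l^-1 * Num.max (l * (v x - m)) 0 + m)%R.
  have intg : P.-integrable [set: T] (EFin \o g).
    by apply: integrableDR; [exact: integrableZR|exact: integrable_cstR].
  apply: le_lt_trans (integrable_lty measurableT intg).
  apply: ae_le_integralT => //.
    by apply/measurable_EFinP; exact: measurable_int intg.
  apply: aeW => x; rewrite /g -lerBlDr ler_pdivlMl//.
  by rewrite le_max lexx.
case Ev : (\int[P]_x (v x)%:E) vfin => [e| |]// _; last by rewrite leNye.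
have intv : P.-integrable [set: T] (EFin \o v).
  by apply: integral_fin_num_integrable => //; rewrite Ev.
rewrite -EFinB; apply: conjugate_inv_ge => l' l'0 l'b.
have intc (c : R) : P.-integrable [set: T] (EFin \o (fun=> c)).
  exact: integrable_cstR.
have [_] := H _ l'0 l'b; rewrite integralZR; last exact: integrableDR.
by rewrite integralDR// integral_cstR Ev -EFinD -EFinM lee_fin.
Qed.

(** [m] is a reference value that may differ from the mean of [v] under [Q]. The Gaussian lower
    bound uses this to compare with the variance of [Q] instead of the mean loss of a noncentral
    action. *)
Lemma KL_expectation_gap P Q v (m r : R) (b : \bar R) (phi : R -> R) :
  measurable_fun [set: T] v -> 0 < b ->
  (forall l : R, (0 <= l)%R -> l%:E < b ->
    \int[Q]_x (expR (l * (v x - m)))%:E <= (expR (phi l))%:E) ->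
  KL P Q = r%:E ->
  \int[P]_x (v x)%:E - m%:E <= conjugate_inv b phi r.
Proof.
move=> mv b0 H KLr; apply: expectation_gap_le => // l l0 lb.
apply: Donsker_Varadhan KLr; last exact: H.
by apply: measurable_funM => //; exact: measurable_funB.
Qed.

Lemma chi2_expectation_gap P Q v (m V r : R) : measurable_fun [set: T] v ->
  \int[Q]_x (v x)%:E = m%:E -> \int[Q]_x ((v x - m) ^+ 2)%:E = V%:E ->
  chi2 P Q = r%:E ->
  \int[P]_x (v x)%:E - m%:E <= (Num.sqrt (V * r))%:E.
Proof.
move=> mv vm vV; rewrite /chi2; case: asboolP => // PQ chir.
have [f [mf f0 fRN ch]] := density_exists PQ.
have intc (c : R) : Q.-integrable [set: T] (EFin \o (fun=> c)).
  exact: integrable_cstR.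
have mf1 : measurable_fun [set: T] (fun x => (f x - 1) ^+ 2)%R.
  by apply: measurable_funX; exact: measurable_funB.
have fr : \int[Q]_x ((f x - 1) ^+ 2)%:E = r%:E.
  rewrite -chir; apply: ae_eq_integral => //.
  - exact/measurable_EFinP.
  - have [g mg ->] := Radon_Nikodym_EFin PQ.
    rewrite (_ : (fun x => _) = EFin \o (fun x => (g x - 1) ^+ 2)%R)//.
    by apply/measurable_EFinP/measurable_funX; exact: measurable_funB.
  - by apply: filterS fRN => x -> _.
have intf1 : Q.-integrable [set: T] (EFin \o (fun x => (f x - 1) ^+ 2)%R).
  by apply: integral_fin_num_integrable => //; rewrite fr.
have mvm : measurable_fun [set: T] (fun x => v x - m)%R.
  exact: measurable_funB.
have intvm : Q.-integrable [set: T] (EFin \o (fun x => (v x - m) ^+ 2)%R).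
  apply: integral_fin_num_integrable; last by rewrite vV.
  exact: measurable_funX.
have intv : Q.-integrable [set: T] (EFin \o v).
  by apply: integral_fin_num_integrable => //; rewrite vm.
(* The change of measure for signed functions asks for [P]-integrability. It comes from |u| f <= u^2
   + (f - 1)^2 + 1 with u = v - m. *)
have intvP : P.-integrable [set: T] (EFin \o (fun x => v x - m)%R).
  apply/integrableP; split; first exact/measurable_EFinP.
  under eq_integral do rewrite /=.
  rewrite ch//; last exact: measurableT_comp.
  pose g x := ((v x - m) ^+ 2 + ((f x - 1) ^+ 2 + 1))%R.
  have intg : Q.-integrable [set: T] (EFin \o g).
    by do 2 apply: integrableDR => //.
  apply: le_lt_trans (integrable_lty measurableT intg).
  apply: ae_le_integralT.
  - by apply: measurable_funM => //; exact: measurableT_comp.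
  - by apply/measurable_EFinP; exact: measurable_int intg.
  - apply: aeW => x; rewrite /g -[((v x - m) ^+ 2)%R]real_normK ?num_real//.
    set a := `|_|%R.
    have := sqr_ge0 (a - f x / 2)%R; have := sqr_ge0 (f x / 2 * 3 - 2)%R.
    nra.
have V0 : (0 <= V)%R.
  by rewrite -lee_fin -vV integral_ge0// => x _; rewrite lee_fin sqr_ge0.
(* The target becomes the bound on the inverse conjugate of l^2 V / 2 at r / 2; optimizing over l
   takes the place of Cauchy-Schwarz. *)
have -> : (V * r = 2 * V * (r / 2))%R by lra.
apply: le_trans (conjugate_inv_quadratic _ V0).
apply: expectation_gap_le => // l l0 _.
have ml : measurable_fun [set: T] (fun x => l * (v x - m))%R.
  exact: measurable_funM.
have intl : P.-integrable [set: T] (EFin \o (fun x => l * (v x - m))%R).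
  exact: integrableZR.
split.
  apply: integral_funpos_lty intl _ => //; exact: aeW.
have -> : \int[P]_x (l * (v x - m))%:E = \int[Q]_x (l * (v x - m) * f x)%:E.
  rewrite -(Radon_Nikodym_change_of_variables PQ measurableT intl).
  apply: ae_eq_integral => //.
  - apply: emeasurable_funM; first exact/measurable_EFinP.
    have [k mk ->] := Radon_Nikodym_EFin PQ; exact/measurable_EFinP.
  - by apply/measurable_EFinP; exact: measurable_funM.
  - by apply: filterS fRN => x -> _; rewrite -EFinM.
(* l u f = l u + (l u) (f - 1), and (l u) (f - 1) <= (l u)^2 / 2 + (f - 1)^2 / 2 *)
pose g x := (l * (v x - m) + (l ^+ 2 / 2 * (v x - m) ^+ 2 +
   2^-1 * (f x - 1) ^+ 2))%R.
have intvmQ : Q.-integrable [set: T] (EFin \o (fun x => v x - m)%R).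
  exact: integrableDR.
have intlQ := integrableZR l intvmQ.
have int1 := integrableZR (l ^+ 2 / 2) intvm.
have int2 := integrableZR 2^-1 intf1.
have intg : Q.-integrable [set: T] (EFin \o g).
  by do 2 apply: integrableDR => //.
apply: (@le_trans _ _ (\int[Q]_x (g x)%:E)).
  apply: ae_le_integralT.
  - exact: measurable_funM.
  - by apply/measurable_EFinP; exact: measurable_int intg.
  - apply: aeW => x; rewrite /g.
    have := sqr_ge0 (l * (v x - m) - (f x - 1))%R; nra.
rewrite integralDR//; last exact: integrableDR.
rewrite integralDR// !integralZR// fr vV integralDR// vm integral_cstR.
rewrite -!EFinM -!EFinD lee_fin; lra.
Qed.

End expectation_gap.

(** * Total variation *)

Section total_variation.
Context {d : measure_display} {T : measurableType d} {R : realType}.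
Implicit Types (P Q : probability T R) (f : T -> R).

Lemma charge_variation_setT (nu : {charge set T -> \bar R}) (A B : set T)
    (AB : hahn_decomposition nu A B) :
  charge_variation AB setT = nu A - nu B.
Proof.
have [[mA _] [mB _] _ _] := AB.
rewrite /charge_variation jordan_posE jordan_negE cjordan_posE cjordan_negE.
by rewrite /crestr0 !mem_set// /crestr !setTI.
Qed.

(** Both measures have mass one, so P - Q takes opposite values on the two Hahn sets: its total
    variation is twice P A - Q A, and the factor 1/2 cancels. *)
Lemma dTV_Hahn P Q : exists A B : set T,
  [/\ measurable A /\ measurable B, A `|` B = setT /\ [disjoint A & B],
    (forall S, measurable S -> S `<=` A -> Q S <= P S),
    (forall S, measurable S -> S `<=` B -> P S <= Q S) &
    dTV P Q = P A - Q A].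
Proof.
pose nu := charge_diff P Q.
pose A := projT1 (cid (Hahn_decomposition nu)).
pose B := projT1 (cid (projT2 (cid (Hahn_decomposition nu)))).
have AB : hahn_decomposition nu A B.
  exact: (projT2 (cid (projT2 (cid (Hahn_decomposition nu))))).
have dTVE : dTV P Q = (2^-1)%:E * (nu A - nu B).
  by rewrite /dTV /total_variation_measure charge_variation_setT.
have [[mA Apos] [mB Bneg] AUB AIB] := AB.
have fin (mu : probability T R) S : measurable S -> mu S \is a fin_num.
  exact: fin_num_measure.
exists A, B; split => //.
- by split => //; apply/eqP.
- by move=> S mS /(Apos _ mS); rewrite sube_ge0 ?fin.
- by move=> S mS /(Bneg _ mS); rewrite sube_le0 ?fin.
- have tot (mu : probability T R) : mu B = 1 - mu A.
    rewrite -(probability_setT mu) -AUB measureU//.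
    by rewrite addeAC subee ?fin// add0e.
  have nuE S : nu S = P S - Q S by [].
  rewrite dTVE !nuE !tot -(fineK (fin P _ mA)) -(fineK (fin Q _ mA)).
  rewrite -!EFinB -EFinM; congr EFin; lra.
Qed.

Lemma le_integral_restr P Q (D : set T) f : measurable D ->
  (forall S, measurable S -> S `<=` D -> P S <= Q S) ->
  measurable_fun [set: T] f -> (forall x, 0 <= f x)%R ->
  \int[P]_(x in D) (f x)%:E <= \int[Q]_(x in D) (f x)%:E.
Proof.
move=> mD PQ mf f0.
rewrite (eq_measure_integral (mrestr P mD)); last first.
  by move=> A mA AD; rewrite /= /mrestr setIidl.
rewrite [leRHS](eq_measure_integral (mrestr Q mD)); last first.
  by move=> A mA AD; rewrite /= /mrestr setIidl.
apply: ge0_le_measure_integral => //.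
- by move=> S mS; rewrite /mrestr; apply: PQ; [exact: measurableI|].
- exact/measurable_EFinP.
Qed.

(** On A, where P dominates, the nonnegative function b - f is compared; on B, where Q dominates, f
    - a is. Adding up, the gap is at most b (P A - Q A) + a (P B - Q B) = (b - a) (P A - Q A). *)
Lemma expectation_gap_dTV P Q f (a b : R) : measurable_fun [set: T] f ->
  (forall x, a <= f x <= b)%R ->
  \int[P]_x (f x)%:E - \int[Q]_x (f x)%:E <= (b - a)%:E * dTV P Q.
Proof.
move=> mf fab; have [A [B [[mA mB] [AUB AB] QP PQ ->]]] := dTV_Hahn P Q.
have intf (mu : probability T R) (D : set T) : measurable D ->
    mu.-integrable D (EFin \o f).
  move=> mD; apply: (integrableS measurableT) => //.
  have := integrable_cstR mu (`|a| + `|b|)%R; apply: le_integrableR => // x.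
  have /andP[afx fxb] := fab x; rewrite ler_norml.
  have := ler_norm b; have := ler_norm (- a); rewrite normrN.
  have := normr_ge0 a; have := normr_ge0 b; lra.
have intc (mu : probability T R) (D : set T) c : measurable D ->
    mu.-integrable D (EFin \o cst c).
  by move=> mD; exact: finite_measure_integrable_cst.
have fin (mu : probability T R) S : measurable S -> mu S \is a fin_num.
  exact: fin_num_measure.
have split (mu : probability T R) : \int[mu]_x (f x)%:E =
    \int[mu]_(x in A) (f x)%:E + \int[mu]_(x in B) (f x)%:E.
  by rewrite -AUB integral_setU// AUB; exact/measurable_EFinP.
have tot (mu : probability T R) : mu B = 1 - mu A.
  rewrite -(probability_setT mu) -AUB measureU//; last exact/eqP.
  by rewrite addeAC subee ?fin// add0e.
have Ble : \int[P]_(x in B) (f x - a)%:E <= \int[Q]_(x in B) (f x - a)%:E.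
  apply: le_integral_restr => //; first exact: measurable_funB.
  by move=> x; have /andP[? _] := fab x; rewrite subr_ge0.
have Ale : \int[Q]_(x in A) (b - f x)%:E <= \int[P]_(x in A) (b - f x)%:E.
  apply: le_integral_restr => //; first exact: measurable_funB.
  by move=> x; have /andP[_ ?] := fab x; rewrite subr_ge0.
move: Ale Ble; rewrite !integralB_EFin ?intf ?intc//.
have cstE (mu : probability T R) (D : set T) (c : R) : measurable D ->
    \int[mu]_(x in D) c%:E = c%:E * mu D.
  by move=> mD; exact: integral_cst.
have real (x : \bar R) : x \is a fin_num -> exists r, x = r%:E.
  by move=> xfin; exists (fine x); rewrite fineK.
have finI (mu : probability T R) (D : set T) : measurable D ->
    exists r, \int[mu]_(x in D) (f x)%:E = r%:E.
  by move=> mD; apply: real; exact: (integrable_fin_num mD (intf mu D mD)).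
rewrite !cstE// !split !tot.
have [p ->] := real _ (fin P _ mA); have [q ->] := real _ (fin Q _ mA).
have [pA ->] := finI P _ mA; have [pB ->] := finI P _ mB.
have [qA ->] := finI Q _ mA; have [qB ->] := finI Q _ mB.
rewrite -?EFinN -?EFinD -?EFinM -?EFinN -?EFinD !lee_fin.
lra.
Qed.

(** The second half of (1) exchanges P and Q. Symmetry follows from the preceding bound for minus
    the indicator of a Hahn set, whose values lie in [-1, 0]. *)
Lemma dTVC P Q : dTV P Q = dTV Q P.
Proof.
suff le P1 P2 : dTV P1 P2 <= dTV P2 P1 by apply/eqP; rewrite eq_le !le.
have [A [_ [[mA _] _ _ _ ->]]] := dTV_Hahn P1 P2.
have m1 : measurable_fun [set: T] (fun x => - \1_A x : R)%R.
  exact: measurableT_comp.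
have := @expectation_gap_dTV P2 P1 (fun x => - \1_A x)%R (-1) 0 m1.
have indicN (mu : probability T R) : \int[mu]_x (- \1_A x)%:E = - mu A.
  by rewrite -(setIT A) -integral_indic// -integral_ge0N// setIT.
rewrite !indicN sub0r opprK mul1e oppeK addeC; apply => x.
by rewrite indicE; case: (x \in A) => /=; apply/andP; split; lra.
Qed.

End total_variation.

(** * Generalized entropies *)

Section entropy_gap.
Context {d : measure_display} {Z : measurableType d} {R : realType}.
Implicit Types (P Q : probability Z R) (X : {mfun Z >-> R}).

Lemma le_bound_at (f : R -> \bar R) (D x : \bar R) :
  (forall r, D = r%:E -> x <= f r) -> x <= bound_at f D.
Proof. by case: D => [r| |] H /=; [exact: H|rewrite leey..]. Qed.

Lemma expectation_distribution P X :
  'E_P[X] = \int[distribution P X]_x x%:E.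
Proof. by rewrite unlock integral_distributionE. Qed.

(** Here [expectation_defined] enters: if both parts had infinite integral, the integrals of X and
    of - X would both be -oo. *)
Lemma expectationN_distribution P X : expectation_defined P X ->
  - 'E_P[X] = \int[distribution P X]_x (- x)%:E.
Proof.
move=> wd; rewrite unlock integral_distributionE//.
by rewrite -(@integralN _ _ _ P setT (EFin \o X)).
Qed.

Lemma mmt_gen_fun_distribution Q X (t m : R) : 'E_Q[X] = m%:E ->
  'M_Q (centered Q X) t = \int[distribution Q X]_x (expR (t * (x - m)))%:E.
Proof.
move=> XE; rewrite integral_distributionE; last first.
  apply: measurableT_comp => //; apply: measurable_funM => //.
  exact: measurable_funB.
rewrite /mmt_gen_fun unlock; apply: eq_integral => x _ /=.
by rewrite /centered XE /= mulrC.
Qed.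

Lemma lne_le_expR (x : \bar R) (y : R) : lne x <= y%:E -> x <= (expR y)%:E.
Proof.
case: x => [x| |] /=; [|by rewrite leye_eq|by move=> _; rewrite leNye].
case: ifPn => [x0 _|].
  by rewrite lee_fin (le_trans x0)// expR_ge0.
rewrite -ltNge => x0; rewrite !lee_fin => xy.
by rewrite -[x]lnK ?posrE// ler_expR.
Qed.

Lemma variance_distribution Q X (m : R) : 'E_Q[X] = m%:E ->
  'V_Q[X] = \int[distribution Q X]_x ((x - m) ^+ 2)%:E.
Proof.
move=> XE; rewrite integral_distributionE; last first.
  by apply: measurable_funX; exact: measurable_funB.
rewrite /variance covariance.unlock XE unlock.
by apply: eq_integral => x _; rewrite expr2.
Qed.

Lemma expectation_real Q X : Q.-integrable [set: Z] (EFin \o X) ->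
  exists m, 'E_Q[X] = m%:E.
Proof.
move=> intX; exists (fine 'E_Q[X]); rewrite fineK// unlock.
exact: (integrable_fin_num measurableT intX).
Qed.

Lemma Lfun2_integrable Q X : (X : Z -> R) \in Lfun Q 2%:E ->
  Q.-integrable [set: Z] (EFin \o X).
Proof.
by move=> ?; apply/Lfun1_integrable; rewrite Lfun_subset12// fin_num_measure.
Qed.

Context {A : Type} (ell : A -> {mfun Z >-> R}).

Lemma gen_entropy_le P a : gen_entropy ell P <= 'E_P[ell a].
Proof. by apply: ereal_inf_lbound; exists a. Qed.

Lemma gen_entropy_gap P Q a (m : R) :
  gen_entropy ell Q = 'E_Q[ell a] -> 'E_Q[ell a] = m%:E ->
  gen_entropy ell P - gen_entropy ell Q <=
    \int[distribution P (ell a)]_x x%:E - m%:E.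
Proof.
move=> -> ->; rewrite -expectation_distribution.
by apply: leeD2r; exact: gen_entropy_le.
Qed.

(** Writing the reverse gap as a gap for the opposite variable keeps [P] in first position, so the
    same one-sided estimates apply with D(P||Q) in its given order. *)
Lemma gen_entropy_gapN P Q a (m : R) : expectation_defined P (ell a) ->
  gen_entropy ell P = 'E_P[ell a] -> 'E_Q[ell a] = m%:E ->
  gen_entropy ell Q - gen_entropy ell P <=
    \int[distribution P (ell a)]_x (- x)%:E - (- m)%:E.
Proof.
move=> wd -> Ea; rewrite -expectationN_distribution// EFinN oppeK addeC.
by apply: leeD2r; rewrite -Ea; exact: gen_entropy_le.
Qed.

Section entropy_bounds.
Variables (P Q : probability Z R) (a : A).
Let P' := distribution P (ell a).
Let Q' := distribution Q (ell a).

Lemma gen_entropy_le_dTV (lo hi : R) :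
  gen_entropy ell Q = 'E_Q[ell a] -> (forall z, lo <= ell a z <= hi)%R ->
  gen_entropy ell P - gen_entropy ell Q <= (hi - lo)%:E * dTV P' Q'.
Proof.
(* The estimate on the line needs a function bounded everywhere, while the identity is bounded only
   on the range of the loss. Clamping to [lo, hi] leaves the loss unchanged. *)
move=> HQ ab; pose clamp (x : R) := Num.max lo (Num.min x hi).
have mclamp : measurable_fun [set: R] clamp.
  by apply: measurable_maxr => //; exact: measurable_minr.
(* [lo <= hi] needs an outcome: a space that carries a probability is nonempty. *)
have [z _] : exists z : Z, True.
  apply: contrapT => /forallNP noz; have := @probability_setT _ _ _ Q.
  rewrite (_ : setT = set0) ?measure0; last first.
    by apply/seteqP; split => // z _; exact: (noz z).
  by move=> /esym/eqP; rewrite onee_eq0.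
have lohi : (lo <= hi)%R by have /andP[/le_trans] := ab z; exact.
have clampE (mu : probability Z R) :
    'E_mu[ell a] = \int[distribution mu (ell a)]_x (clamp x)%:E.
  rewrite integral_distributionE// unlock; apply: eq_integral => x _.
  have /andP[lox xhi] := ab x; rewrite /clamp.
  by rewrite (min_idPl xhi) (max_idPr lox).
apply: (@le_trans _ _ ('E_P[ell a] - 'E_Q[ell a])).
  by rewrite HQ; apply: leeD2r; exact: gen_entropy_le.
rewrite !clampE; apply: expectation_gap_dTV => // x.
by rewrite le_max lexx ge_max lohi ge_min lexx orbT.
Qed.

Lemma gen_entropy_le_KL (b : \bar R) (phi : R -> R) (r : R) :
  gen_entropy ell Q = 'E_Q[ell a] -> Q.-integrable [set: Z] (EFin \o ell a) ->
  0 < b ->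
  (forall l : R, (0 <= l)%R -> l%:E < b ->
    'M_Q (centered Q (ell a)) l <= (expR (phi l))%:E) ->
  KL P' Q' = r%:E ->
  gen_entropy ell P - gen_entropy ell Q <= conjugate_inv b phi r.
Proof.
move=> HQ /expectation_real[m Em] b0 H KLr.
apply: le_trans (gen_entropy_gap P HQ Em) _.
apply: KL_expectation_gap KLr => // l l0 lb.
by rewrite -mmt_gen_fun_distribution//; exact: H.
Qed.

Lemma gen_entropy_ge_KL (b : \bar R) (phi : R -> R) (r : R) :
  expectation_defined P (ell a) ->
  gen_entropy ell P = 'E_P[ell a] -> Q.-integrable [set: Z] (EFin \o ell a) ->
  0 < b ->
  (forall l : R, (0 <= l)%R -> l%:E < b ->
    'M_Q (centered Q (ell a)) (- l) <= (expR (phi l))%:E) ->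
  KL P' Q' = r%:E ->
  gen_entropy ell Q - gen_entropy ell P <= conjugate_inv b phi r.
Proof.
move=> wd HP /expectation_real[m Em] b0 H KLr.
apply: le_trans (gen_entropy_gapN wd HP Em) _.
apply: KL_expectation_gap KLr => // l l0 lb.
have := H _ l0 lb; rewrite (mmt_gen_fun_distribution _ Em).
apply: le_trans; rewrite le_eqVlt; apply/orP; left; apply/eqP.
by apply: eq_integral => x _; rewrite -opprB opprK mulrN mulNr addrC.
Qed.

Lemma gen_entropy_le_chi2 (r : R) :
  gen_entropy ell Q = 'E_Q[ell a] -> (ell a : Z -> R) \in Lfun Q 2%:E ->
  chi2 P' Q' = r%:E ->
  gen_entropy ell P - gen_entropy ell Q <=
    (Num.sqrt (fine 'V_Q[ell a] * r))%:E.
Proof.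
move=> HQ L2 chir; have [m Em] := expectation_real (Lfun2_integrable L2).
apply: le_trans (gen_entropy_gap P HQ Em) _.
apply: chi2_expectation_gap chir => //.
- by rewrite -expectation_distribution.
- by rewrite -variance_distribution// fineK// variance_fin_num.
Qed.

Lemma gen_entropy_ge_chi2 (r : R) : expectation_defined P (ell a) ->
  gen_entropy ell P = 'E_P[ell a] -> (ell a : Z -> R) \in Lfun Q 2%:E ->
  chi2 P' Q' = r%:E ->
  gen_entropy ell Q - gen_entropy ell P <=
    (Num.sqrt (fine 'V_Q[ell a] * r))%:E.
Proof.
move=> wd HP L2 chir; have intQ := Lfun2_integrable L2.
have [m Em] := expectation_real intQ.
apply: le_trans (gen_entropy_gapN wd HP Em) _.
apply: chi2_expectation_gap chir => //.
- rewrite -expectationN_distribution ?Em//; exact: integrable_add_def.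
- under eq_integral do rewrite opprK addrC -sqrrN opprB.
  by rewrite -variance_distribution// fineK// variance_fin_num.
Qed.

End entropy_bounds.

End entropy_gap.

(** * Quadratic loss under a Gaussian *)

Section logarithm_bounds.
Context {R : realType}.

Lemma is_derive_ge0_le (F dF : R -> R) (s : R) : (0 <= s)%R ->
  (forall x, 0 <= x <= s -> is_derive x 1 F (dF x))%R ->
  (forall x, 0 <= x <= s -> 0 <= dF x)%R -> (F 0 <= F s)%R.
Proof.
move=> s0 der dF0.
have itv x : x \in `]0, s[%R -> (0 <= x <= s)%R.
  by rewrite in_itv/= => /andP[x0 xs]; rewrite !ltW.
apply: (@ger0_derive1_ndecr R F 0 s) => //.
- by move=> x /itv /der Fx; exact: ex_derive.
- by move=> x /itv xs; rewrite derive1E (@derive_val _ _ _ _ _ _ _ (der x xs)) dF0.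
- apply: derivable_within_continuous => x; rewrite in_itv /= => xs.
  have Fx := der x xs; exact: ex_derive.
Qed.

(** The difference of the two sides has derivative x^2 / (1 + x). *)
Lemma ln1D_ge (s : R) : (0 <= s)%R -> (s - s ^+ 2 / 2 <= ln (1 + s))%R.
Proof.
move=> s0; pose F (x : R) := (ln (1 + x) - x + x ^+ 2 / 2)%R.
suff : (F 0 <= F s)%R by rewrite /F addr0 ln1 expr0n /=; lra.
apply: (@is_derive_ge0_le F (fun x => (1 + x)^-1 - 1 + x)%R) => // x /andP[x0 _].
  have x1 : (0 < 1 + x)%R by lra.
  have := is_derive1_ln x1 => lnx.
  rewrite /F; apply: is_derive_eq.
  rewrite /GRing.scale /=; lra.
have -> : ((1 + x)^-1 - 1 + x = x ^+ 2 / (1 + x))%R by field; lra.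
by rewrite divr_ge0 ?sqr_ge0//; lra.
Qed.

Lemma le_sinh (y : R) : (0 <= y)%R -> (y <= (expR y - expR (- y)) / 2)%R.
Proof.
move=> y0; pose F (x : R) := (expR x - expR (- x) - 2 * x)%R.
suff : (F 0 <= F y)%R by rewrite /F oppr0 subrr mulr0; lra.
apply: (@is_derive_ge0_le F (fun x => expR x + expR (- x) - 2)%R) => // x _.
  rewrite /F; apply: is_derive_eq.
  rewrite /GRing.scale /=; lra.
by have := expR_ge1Dx x; have := expR_ge1Dx (- x); lra.
Qed.

(** This is y <= sinh y at y = - ln (1 - s), where exp y = 1 / (1 - s) and exp (- y) = 1 - s. *)
Lemma ln1B_ge (s : R) : (0 <= s < 1)%R ->
  (- ln (1 - s) - s <= s ^+ 2 / (2 * (1 - s)))%R.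
Proof.
move=> /andP[s0 s1]; have s1' : (0 < 1 - s)%R by lra.
have ln0 : (0 <= - ln (1 - s))%R by rewrite oppr_ge0 ln_le0//; lra.
have := le_sinh ln0; rewrite opprK lnK ?posrE// expRN lnK ?posrE//.
have -> : (s ^+ 2 / (2 * (1 - s)) = ((1 - s)^-1 - (1 - s)) / 2 - s)%R.
  by field; lra.
lra.
Qed.

(** Both signs of s are covered because the centering argument perturbs in both directions. For s >=
    0 the condition makes 2 (1 - s) at least 1. *)
Lemma ln1B_le_sqr (s : R) : (`|s| <= 1 / 2)%R -> (- ln (1 - s) - s <= s ^+ 2)%R.
Proof.
rewrite ler_norml => /andP[sN sP]; have [s0|s0] := leP 0%R s.
  apply: (le_trans (@ln1B_ge s _)); first lra.
  rewrite ler_pdivrMr; last lra.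
  by rewrite ler_peMr ?sqr_ge0//; lra.
have := @ln1D_ge (- s)%R; rewrite sqrrN => /(_ ltac:(lra)).
have := sqr_ge0 s; lra.
Qed.

End logarithm_bounds.

(** * Mean zero from exponential moments *)

Section centered_mgf.
Context {d : measure_display} {T : measurableType d} {R : realType}.

(* Jensen's inequality gives t * E[W] <= C t^2 for all small t of either sign. *)
Lemma mgf_quadratic_centered (Q : probability T R) (W : T -> R) (e C : R) :
  measurable_fun [set: T] W -> (0 < e)%R ->
  (forall t, (`|t| <= e)%R ->
    \int[Q]_x (expR (t * W x))%:E <= (expR (C * t ^+ 2))%:E) ->
  Q.-integrable [set: T] (EFin \o W) /\ \int[Q]_x (W x)%:E = 0.
Proof.
move=> mW e0 H.
have mexp t : measurable_fun [set: T] (fun x => expR (t * W x)).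
  by apply: measurableT_comp => //; exact: measurable_funM.
have intexp t : (`|t| <= e)%R ->
    Q.-integrable [set: T] (EFin \o (fun x => expR (t * W x))).
  move=> te; apply: ge0_integrable_lty => //.
  by apply: le_lt_trans (H _ te) _; rewrite ltry.
have intW : Q.-integrable [set: T] (EFin \o W).
  have ee : (`|e| <= e)%R by rewrite gtr0_norm.
  have eNe : (`|- e| <= e)%R by rewrite normrN.
  (* Domination: e |W| <= exp (e W) + exp (- e W). *)
  have := integrableZR e^-1 (integrableDR (intexp _ ee) (intexp _ eNe)).
  apply: le_integrableR => // x; rewrite ler_pdivlMl//.
  have := expR_ge1Dx (e * W x); have := expR_ge1Dx (- e * W x).
  have := expR_ge0 (e * W x); have := expR_ge0 (- e * W x).
  have [W0|W0] := ger0P (W x); nra.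
split => //; have /fineK := integrable_fin_num measurableT intW.
set mu := fine _; rewrite -[X in _ = X]/(\int[Q]_x (W x)%:E) => muE.
rewrite -muE; congr EFin.
have Jensen t : (`|t| <= e)%R -> (t * mu <= C * t ^+ 2)%R.
  move=> te; rewrite -ler_expR -lee_fin; apply: le_trans (H _ te).
  (* The tangent of exp at t mu, evaluated at t W; its mean is exp (t mu). *)
  pose g x := (expR (t * mu) + expR (t * mu) * (t * W x - t * mu))%R.
  have intc (c : R) : Q.-integrable [set: T] (EFin \o (fun=> c)).
    exact: integrable_cstR.
  have int1 : Q.-integrable [set: T] (EFin \o (fun x => t * W x - t * mu)%R).
    by apply: integrableDR => //; exact: integrableZR.
  have int2 := integrableZR (expR (t * mu)) int1.
  have <- : \int[Q]_x (g x)%:E = (expR (t * mu))%:E.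
    rewrite integralDR// integral_cstR integralZR// integralDR//; last first.
      exact: integrableZR.
    rewrite integralZR// integral_cstR -muE.
    rewrite -!EFinM -!EFinD.
    by rewrite subrr mulr0 addr0.
  apply: ae_le_integralT => //.
    by apply/measurable_EFinP; apply: measurable_int (integrableDR _ int2).
  apply: aeW => x; rewrite /g -[X in (X + _)%R]mulr1 -mulrDr.
  rewrite -[in leRHS](subrK (t * mu)%R (t * W x)%R) expRD mulrC.
  by rewrite ler_pM2r ?expR_gt0// expR_ge1Dx.
(* Take t of the sign of mu with |t| = c. Dividing by c leaves |mu| <= C c, whereas the choice of c
   gives C c <= |mu| / 2. *)
apply/eqP/negPn/negP => mu0; pose c := Num.min e (`|mu| / (`|C| + 1) / 2)%R.
have C1 : (0 < `|C| + 1)%R by have := normr_ge0 C; lra.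
have mu1 : (0 < `|mu|)%R by rewrite normr_gt0.
have c0 : (0 < c)%R by rewrite lt_min e0 !divr_gt0.
have ce : (c <= e)%R by rewrite ge_min lexx.
have cmu : (c * (`|C| + 1) * 2 <= `|mu|)%R.
  by rewrite -ler_pdivlMr// -ler_pdivlMr// mulrAC ge_min lexx orbT.
have : (c * `|mu| <= C * c ^+ 2)%R.
  have [mug|mul] := ger0P mu.
    by apply: Jensen; rewrite gtr0_norm.
  have := Jensen (- c)%R; rewrite normrN gtr0_norm// mulNr mulrN sqrrN; exact.
rewrite expr2 mulrCA ler_pM2l//.
have := ler_norm C; have := normr_ge0 C; nra.
Qed.

End centered_mgf.

(** * Exponential moments of a Gaussian *)

Section gaussian.
Context {R : realType}.

(** Tilting a centered Gaussian of variance v by exp (a u^2 + b u) gives, up to a constant, the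
    Gaussian of variance v / D and mean b v / D, where D = 1 - 2 a v. *)
Lemma complete_square (u v a b : R) : v != 0%R -> (1 - 2 * a * v != 0)%R ->
  (- (u - b * v / (1 - 2 * a * v)) ^+ 2 / (2 * (v / (1 - 2 * a * v))) =
  a * u ^+ 2 + b * u - u ^+ 2 / (2 * v) - b ^+ 2 * v / (2 * (1 - 2 * a * v)))%R.
Proof.
move=> v0 D0; set D := (1 - 2 * a * v)%R in D0 *.
have -> : a = ((1 - D) / (2 * v))%R by rewrite /D; field.
clearbody D.
have -> : (2 * (v / D))%R = (2 * v / D)%R by rewrite mulrA.
have -> : ((u - b * v / D) = (u * D - b * v) / D)%R by field.
have -> : (- ((u * D - b * v) / D) ^+ 2 / (2 * v / D) =
    - ((u * D - b * v) ^+ 2) / (2 * v * D))%R.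
by field; rewrite D0 v0.
field.
by rewrite D0 v0.
Qed.

Variables (Q : probability (measurableTypeR R) R) (m sigma : R).
Hypothesis sigma0 : (0 < sigma)%R.
Hypothesis Qnormal : forall B : set (measurableTypeR R), measurable B ->
  Q B = normal_prob m sigma B.

(** The Radon-Nikodym derivative of [normal_prob] and [normal_pdf] have the same integral over every
    measurable set, so they agree almost everywhere, and the change of variables for the former
    carries over to the latter. *)
Lemma integral_normal (g : measurableTypeR R -> R) :
  measurable_fun [set: measurableTypeR R] g -> (forall x, 0 <= g x)%R ->
  \int[Q]_x (g x)%:E =
  \int[lebesgue_measure]_x (g x * normal_pdf m sigma x)%:E.
Proof.
move=> mg g0; rewrite (eq_measure_integral (normal_prob m sigma)); last first.
  by move=> A mA _; exact: Qnormal.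
have dom := @normal_prob_dominates R m sigma.
pose F := Radon_Nikodym_SigmaFinite.f (normal_prob m sigma) (@lebesgue_measure R).
have intF := Radon_Nikodym_SigmaFinite.f_integrable dom.
have Fpdf : ae_eq lebesgue_measure setT F (fun x => (normal_pdf m sigma x)%:E).
  apply: integral_ae_eq => //.
  - by apply/measurable_EFinP; exact: measurable_normal_pdf.
  - by move=> A _ mA; rewrite -Radon_Nikodym_SigmaFinite.f_integral.
rewrite -(@Radon_Nikodym_SigmaFinite.change_of_variables _ _ _ _ _ dom
  (EFin \o g))//; last exact/measurable_EFinP.
apply: ae_eq_integral => //.
- apply: emeasurable_funM; first exact/measurable_EFinP.
  exact: measurable_int intF.
- apply/measurable_EFinP; apply: measurable_funM => //.
  exact: measurable_normal_pdf.
- by apply: filterS Fpdf => x /(_ I); rewrite -/F EFinM /= => ->.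
Qed.

Lemma normal_peakE (s : R) : (0 < s)%R ->
  normal_peak s = (s^-1 * (Num.sqrt (pi *+ 2))^-1)%R.
Proof.
move=> s0; rewrite /normal_peak -mulrnAr sqrtrM ?sqr_ge0// sqrtr_sqr.
by rewrite gtr0_norm// invfM.
Qed.

(* Complete the square: up to a constant, the integrand is the density of a
   Gaussian with variance sigma ^ 2 / (1 - 2 a sigma ^ 2). *)
Lemma normal_quadratic_mgf (a b : R) : (2 * a * sigma ^+ 2 < 1)%R ->
  \int[Q]_x (expR (a * (x - m) ^+ 2 + b * (x - m)))%:E =
  (expR (b ^+ 2 * sigma ^+ 2 / (2 * (1 - 2 * a * sigma ^+ 2))
         - ln (1 - 2 * a * sigma ^+ 2) / 2))%:E.
Proof.
move=> a1; set D := (1 - 2 * a * sigma ^+ 2)%R.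
have D0 : (0 < D)%R by rewrite /D; lra.
(* The square root of D, written as an exponential to match the logarithm in the exponent of the
   result. *)
pose rD := expR (ln D / 2); have rD0 : (0 < rD)%R by exact: expR_gt0.
have rD2 : (rD ^+ 2 = D)%R.
  by rewrite /rD expr2 -expRD -splitr lnK.
pose s := (sigma / rD)%R; have s0 : (0 < s)%R by rewrite divr_gt0.
pose mu := (m + b * sigma ^+ 2 / D)%R.
set K := expR _.
have KE : K = (expR (b ^+ 2 * sigma ^+ 2 / (2 * D)) / rD)%R.
  by rewrite /K expRB.
have mg : measurable_fun [set: measurableTypeR R]
    (fun x => expR (a * (x - m) ^+ 2 + b * (x - m))).
  apply: measurableT_comp => //; apply: measurable_funD; apply: measurable_funM => //.
    by apply: measurable_funX; exact: measurable_funB.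
  exact: measurable_funB.
rewrite integral_normal//.
transitivity (\int[lebesgue_measure]_x (K * normal_pdf mu s x)%:E).
  apply: eq_integral => x _; congr EFin.
  rewrite !normal_pdfE ?gt_eqF// /normal_fun !normal_peakE//.
  have -> : (- (x - mu) ^+ 2 / (s ^+ 2 *+ 2) =
      a * (x - m) ^+ 2 + b * (x - m) - (x - m) ^+ 2 / (sigma ^+ 2 *+ 2)
      - b ^+ 2 * sigma ^+ 2 / (2 * D))%R.
    rewrite /s exprMn exprVn rD2 /mu opprD addrA -(mulr_natl (_ / D) 2)
      -(mulr_natl (sigma ^+ 2) 2).
    by apply: complete_square; rewrite gt_eqF// exprn_gt0.
  rewrite KE /s mulNr expRN [in RHS]expRB [in RHS]expRB; field.
  by rewrite !gt_eqF ?expR_gt0// sqrtr_gt0 pmulrn_lgt0// pi_gt0.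
rewrite integralZR; last exact: integrable_normal_pdf.
by rewrite integral_normal_pdf mule1.
Qed.

Lemma normal_centered :
  Q.-integrable setT (EFin \o (fun x => x - m)%R) /\
  \int[Q]_x (x - m)%:E = 0.
Proof.
apply: (@mgf_quadratic_centered _ _ _ Q _ 1 (sigma ^+ 2 / 2)) => //.
  exact: measurable_funB.
move=> t _; have := @normal_quadratic_mgf 0 t.
rewrite !(mulr0, mul0r, subr0, ln1) mulr1 => /(_ ltr01).
under eq_integral do rewrite mul0r add0r.
by move=> ->; rewrite lee_fin ler_expR; lra.
Qed.

Lemma normal_sqr_mgf (l : R) : (2 * l * sigma ^+ 2 < 1)%R ->
  \int[Q]_x (expR (l * ((x - m) ^+ 2 - sigma ^+ 2)))%:E =
  (expR (- ln (1 - 2 * l * sigma ^+ 2) / 2 - l * sigma ^+ 2))%:E.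
Proof.
move=> l1; have := normal_quadratic_mgf 0 l1.
rewrite expr0n /= !mul0r add0r; under eq_integral do rewrite mul0r addr0.
move=> E.
under eq_integral do rewrite mulrBr expRD mulrC EFinM.
rewrite ge0_integralZl//; last first.
  apply/measurable_EFinP; apply: measurableT_comp => //.
  by apply: measurable_funM => //; apply: measurable_funX; exact: measurable_funB.
by rewrite E -EFinM -expRD; congr (expR _)%:E; lra.
Qed.

(** Centering applied to (x - m)^2 - sigma^2. With s = 2 t sigma^2 its log-moment is (- ln (1 - s) -
    s) / 2; the range |t| <= 1 / (4 sigma^2) means |s| <= 1/2, whence the bound s^2 / 2 = 2 sigma^4
    t^2. *)
Lemma normal_variance :
  Q.-integrable setT (EFin \o (fun x => (x - m) ^+ 2)%R) /\
  \int[Q]_x ((x - m) ^+ 2)%:E = (sigma ^+ 2)%:E.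
Proof.
have v0 : (0 < sigma ^+ 2)%R by rewrite exprn_gt0.
have [] := @mgf_quadratic_centered _ _ _ Q
  (fun x => (x - m) ^+ 2 - sigma ^+ 2)%R (4 * sigma ^+ 2)^-1%R
  (2 * sigma ^+ 2 ^+ 2)%R.
- by apply: measurable_funB => //; apply: measurable_funX; exact: measurable_funB.
- by rewrite invr_gt0 mulr_gt0.
- move=> t te; pose s := (2 * t * sigma ^+ 2)%R.
  have s2 : (`|s| <= 1 / 2)%R.
    rewrite /s normrM normrM (gtr0_norm v0) normr_nat.
    by move: te; rewrite -[(_^-1)%R]mul1r ler_pdivlMr ?mulr_gt0//; lra.
  have /andP[sN sP] : (- (1 / 2) <= s <= 1 / 2)%R by rewrite -ler_norml.
  rewrite normal_sqr_mgf -/s; last by lra.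
  rewrite lee_fin ler_expR.
  have := ln1B_le_sqr s2; rewrite /s; nra.
move=> intW W0.
have int2 : Q.-integrable setT (EFin \o (fun x => (x - m) ^+ 2)%R).
  have := integrableDR intW (integrable_cstR Q (sigma ^+ 2)).
  by apply: eq_integrable => // x _; rewrite /= subrK.
split => //; move: W0; rewrite integralDR// ?integral_cstR; last first.
  exact: integrable_cstR.
move=> /(congr1 (fun y => y + (sigma ^+ 2)%:E)).
by rewrite EFinN subeK// add0e.
Qed.

End gaussian.

(** * The variance as a generalized entropy, and its gap to a Gaussian *)

Section quadratic_loss.
Context {R : realType}.
Implicit Types (P Q : probability (measurableTypeR R) R).

Lemma expectation_sqloss P (a : R) :
  'E_P[quadratic_loss a] = \int[P]_x ((x - a) ^+ 2)%:E.
Proof. by rewrite unlock. Qed.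

Lemma variance_idfun P :
  'V_P[idfun] = 'E_P[quadratic_loss (fine 'E_P[idfun])].
Proof.
rewrite expectation_sqloss /variance covariance.unlock.
set c := fine _; rewrite unlock.
by apply: eq_integral => x _; rewrite expr2.
Qed.

(** Finite risk of one action suffices: expanding (x - b)^2 around a expresses every risk through
    the first two moments of x - a, which are then finite. *)
Lemma bias_variance P (a : R) : 'E_P[quadratic_loss a] < +oo ->
  exists mu V : R, 'E_P[idfun] = mu%:E /\
    forall b, 'E_P[quadratic_loss b] = (V + (b - mu) ^+ 2)%:E.
Proof.
rewrite expectation_sqloss => aoo.
have ma : measurable_fun [set: measurableTypeR R] (fun x : R => x - a)%R.
  exact: measurable_funB.
have int2 : P.-integrable setT (EFin \o (fun x : R => (x - a) ^+ 2)%R).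
  apply: ge0_integrable_lty => //; first exact: measurable_funX.
  by move=> x; exact: sqr_ge0.
have intc (c : R) := integrable_cstR P c.
have int1 : P.-integrable setT (EFin \o (fun x : R => x - a)%R).
  have := integrableDR int2 (intc 1%R); apply: le_integrableR => // x.
  rewrite -[((x - a) ^+ 2)%R]real_normK ?num_real//.
  have := sqr_ge0 (`|x - a| - 1)%R; nra.
have [A EA] : exists A, \int[P]_x ((x - a) ^+ 2)%:E = A%:E.
  exists (fine (\int[P]_x ((x - a) ^+ 2)%:E)); rewrite fineK//.
  exact: (integrable_fin_num measurableT int2).
have [B EB] : exists B, \int[P]_x (x - a)%:E = B%:E.
  exists (fine (\int[P]_x (x - a)%:E)); rewrite fineK//.
  exact: (integrable_fin_num measurableT int1).
exists (B + a)%R, (A - B ^+ 2)%R; split.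
  rewrite unlock; transitivity (\int[P]_x (x - a + a)%:E).
    by apply: eq_integral => x _; rewrite subrK.
  by rewrite integralDR// EB integral_cstR.
move=> b; rewrite expectation_sqloss.
transitivity (\int[P]_x ((x - a) ^+ 2 + (2 * (a - b) * (x - a) + (a - b) ^+ 2))%:E).
  by apply: eq_integral => x _; congr EFin; lra.
have int1' := integrableZR (2 * (a - b)) int1.
rewrite integralDR//; last exact: integrableDR.
rewrite integralDR// integralZR// integral_cstR EA EB -EFinM -!EFinD.
by congr EFin; lra.
Qed.

Lemma gen_entropy_quadratic P :
  gen_entropy (@quadratic_loss R) P = 'V_P[idfun].
Proof.
apply/eqP; rewrite eq_le; apply/andP; split.
  by rewrite variance_idfun; exact: gen_entropy_le.
apply: le_ereal_inf_tmp => _ [a _ <-].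
have [aoo|] := ltP 'E_P[quadratic_loss a] +oo; last first.
  by rewrite leye_eq => /eqP ->; rewrite leey.
have [mu [V [Emu EV]]] := bias_variance aoo.
by rewrite variance_idfun Emu !EV lee_fin subrr expr0n addr0 lerDl sqr_ge0.
Qed.

Lemma quadratic_minimizer P (a : R) : 'V_P[idfun] < +oo ->
  gen_entropy (@quadratic_loss R) P = 'E_P[quadratic_loss a] ->
  a%:E = 'E_P[idfun].
Proof.
move=> Voo Ha; have := Voo; rewrite variance_idfun => /bias_variance.
move=> [mu [V [Emu EV]]]; move: Ha.
rewrite gen_entropy_quadratic variance_idfun Emu !EV subrr expr0n addr0.
move=> [] /eqP; rewrite -subr_eq0 opprD addNKr oppr_eq0 sqrf_eq0 subr_eq0.
by move=> /eqP ->.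
Qed.

Lemma variance_idfun_Lfun2 P : (idfun : measurableTypeR R -> R) \in Lfun P 2%:E ->
  'V_P[idfun] < +oo.
Proof. by move=> /variance_fin_num; rewrite ge0_fin_numE// variance_ge0. Qed.

Lemma KL_ge0 d (T : measurableType d) (P Q : probability T R) (r : R) :
  KL P Q = r%:E -> (0 <= r)%R.
Proof.
move=> KLr; have [//||_] := @Donsker_Varadhan _ _ _ P Q (fun=> 0%R) 0 r _ _ KLr.
  by rewrite expR0 integral_cstR.
by rewrite integral_cstR addr0 lee_fin.
Qed.

(** The test value l = q / ((1 + 2 q) sigma^2), which minimizes (q^2 + phi l) / l, gives g <= 2
    sigma^2 (q + q^2) whenever r <= q^2. For r > 0, q is sqrt r. *)
Lemma conjugate_inv_chi_square (sigma r : R) : (0 < sigma)%R -> (0 <= r)%R ->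
  conjugate_inv (2 * sigma ^+ 2)^-1%:E
    (fun l => (2 * l * sigma ^+ 2) ^+ 2 / (4 * (1 - 2 * l * sigma ^+ 2)))%R r
  <= (2 * sigma ^+ 2 * (Num.sqrt r + r))%:E.
Proof.
move=> sigma0 r0; apply: conjugate_inv_le => g H.
have v0 : (0 < sigma ^+ 2)%R by rewrite exprn_gt0.
have {}H q : (0 < q -> r <= q ^+ 2 -> g <= 2 * sigma ^+ 2 * (q + q ^+ 2))%R.
  move=> q0 rq; have q1 : (0 < 1 + 2 * q)%R by lra.
  have lE : (2 * (q / ((1 + 2 * q) * sigma ^+ 2)) * sigma ^+ 2 =
      2 * q / (1 + 2 * q))%R.
    by field; rewrite !gt_eqF.
  have := H (q / ((1 + 2 * q) * sigma ^+ 2))%R.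
  have -> : (0 <= q / ((1 + 2 * q) * sigma ^+ 2))%R.
    by rewrite divr_ge0 ?mulr_ge0 ?ltW.
  have -> : (q / ((1 + 2 * q) * sigma ^+ 2))%:E < (2 * sigma ^+ 2)^-1%:E.
    rewrite lte_fin ltr_pdivrMr ?mulr_gt0//.
    rewrite [ltRHS](_ : _ = (1 + 2 * q) / 2)%R; last by field; rewrite gt_eqF.
    lra.
  move=> /(_ isT isT); rewrite lE.
  have -> : ((2 * q / (1 + 2 * q)) ^+ 2 / (4 * (1 - 2 * q / (1 + 2 * q))) =
     q ^+ 2 / (1 + 2 * q))%R.
    by field; lra.
  rewrite mulrAC ler_pdivrMr ?mulr_gt0// => Hq.
  have {}Hq : (q * g <= (r * (1 + 2 * q) + q ^+ 2) * sigma ^+ 2)%R.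
    by apply: (le_trans Hq); rewrite mulrA mulrDl divfK ?gt_eqF.
  rewrite -(ler_pM2l q0); apply: (le_trans Hq).
  have : (r * (1 + 2 * q) <= q ^+ 2 * (1 + 2 * q))%R by rewrite ler_pM2r.
  move=> rq'; rewrite [leRHS](_ : _ =
    (q ^+ 2 * (1 + 2 * q) + q ^+ 2) * sigma ^+ 2)%R; last by lra.
  by rewrite ler_pM2r// lerD2r.
move: r0; rewrite le_eqVlt => /predU1P[r0|r0]; last first.
  have := H (Num.sqrt r); rewrite sqrtr_gt0 (sqr_sqrtr (ltW r0)) r0 lexx; exact.
rewrite -r0 sqrtr0 addr0 mulr0 leNgt; apply/negP => g0.
(* At r = 0 a small positive q replaces sqrt r: this one gives g <= 2 sigma^2 (q + q^2) <= 4 sigma^2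
   q <= g / 2, against g > 0. *)
pose q := Num.min 1%R (g / (8 * sigma ^+ 2))%R.
have q0 : (0 < q)%R by rewrite lt_min ltr01 divr_gt0// mulr_gt0.
have q1 : (q <= 1)%R by rewrite ge_min lexx.
have qg : (q * (8 * sigma ^+ 2) <= g)%R.
  by rewrite -ler_pdivlMr ?mulr_gt0// ge_min lexx orbT.
have := H q q0; rewrite -r0 sqr_ge0 => /(_ isT).
have : (q ^+ 2 <= q)%R by rewrite expr2 ler_piMl// ltW.
nra.
Qed.

Section normal.
Variables (P Q : probability (measurableTypeR R) R) (m sigma : R).
Hypothesis sigma0 : (0 < sigma)%R.
Hypothesis Qnormal : forall B : set (measurableTypeR R), measurable B ->
  Q B = normal_prob m sigma B.

Lemma expectation_normal : 'E_Q[idfun] = m%:E.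
Proof.
have [int0 E0] := normal_centered sigma0 Qnormal.
rewrite unlock; transitivity (\int[Q]_x (x - m + m)%:E).
  by apply: eq_integral => x _; rewrite subrK.
by rewrite integralDR ?E0 ?integral_cstR ?add0e//; exact: integrable_cstR.
Qed.

Lemma variance_normal : 'V_Q[idfun] = (sigma ^+ 2)%:E.
Proof.
rewrite variance_idfun expectation_normal expectation_sqloss /=.
exact: (normal_variance sigma0 Qnormal).2.
Qed.

Lemma variance_gap_normal_le (r : R) :
  KL (distribution P (quadratic_loss m)) (distribution Q (quadratic_loss m))
    = r%:E ->
  'V_P[idfun] - 'V_Q[idfun] <= (2 * sigma ^+ 2 * (Num.sqrt r + r))%:E.
Proof.
move=> KLr; apply: le_trans (conjugate_inv_chi_square sigma0 (KL_ge0 KLr)).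
have v0 : (0 < sigma ^+ 2)%R by rewrite exprn_gt0.
have Em : 'E_Q[quadratic_loss m] = (sigma ^+ 2)%:E.
  by rewrite -variance_normal variance_idfun expectation_normal.
rewrite -!gen_entropy_quadratic.
apply: (le_trans (@gen_entropy_gap _ _ _ _ (@quadratic_loss R) P Q m _ _ Em)).
  by rewrite gen_entropy_quadratic variance_normal Em.
apply: KL_expectation_gap KLr => //.
  by rewrite lte_fin invr_gt0 mulr_gt0.
move=> l l0; rewrite lte_fin -[ltRHS]mul1r ltr_pdivlMr ?mulr_gt0// => l1.
have s1 : (0 <= 2 * l * sigma ^+ 2 < 1)%R.
  by apply/andP; split; [rewrite !mulr_ge0// ltW|lra].
rewrite integral_distributionE; last first.
  apply: measurableT_comp => //; apply: measurable_funM => //.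
  exact: measurable_funB.
rewrite [leLHS](normal_sqr_mgf sigma0 Qnormal (andP s1).2).
rewrite lee_fin ler_expR; have := ln1B_ge s1.
rewrite [X in (_ <= X)%R -> _](_ : _ = 2 *
  ((2 * l * sigma ^+ 2) ^+ 2 / (4 * (1 - 2 * l * sigma ^+ 2))))%R.
  lra.
by field; case/andP: s1; lra.
Qed.

(* The noncentrality (m - a) ^ 2 only decreases the exponential moment. *)
Lemma normal_sqloss_mgf (a l : R) : (0 <= l)%R ->
  \int[Q]_x (expR (l * (- (x - a) ^+ 2 + sigma ^+ 2)))%:E <=
  (expR (l ^+ 2 * (2 * sigma ^+ 2 ^+ 2) / 2))%:E.
Proof.
move=> l0; have v0 : (0 < sigma ^+ 2)%R by rewrite exprn_gt0.
pose c := (l * (sigma ^+ 2 - (a - m) ^+ 2))%R.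
have l1 : (2 * - l * sigma ^+ 2 < 1)%R.
  have : (0 <= l * sigma ^+ 2)%R by rewrite mulr_ge0// ltW.
  lra.
rewrite (eq_integral (fun x : measurableTypeR R => (expR c)%:E *
    (expR (- l * (x - m) ^+ 2 + 2 * l * (a - m) * (x - m)))%:E)); last first.
  by move=> x _; rewrite -EFinM -expRD; congr (expR _)%:E; rewrite /c; lra.
rewrite ge0_integralZl//; last first.
  apply/measurable_EFinP; apply: measurableT_comp => //.
  apply: measurable_funD; apply: measurable_funM => //.
    by apply: measurable_funX; exact: measurable_funB.
  exact: measurable_funB.
rewrite (normal_quadratic_mgf sigma0 Qnormal _ l1) -EFinM -expRD lee_fin ler_expR.
have -> : (1 - 2 * - l * sigma ^+ 2 = 1 + 2 * l * sigma ^+ 2)%R by lra.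
have s0 : (0 <= 2 * l * sigma ^+ 2)%R by rewrite !mulr_ge0// ltW.
have := ln1D_ge s0; rewrite /c.
(* The linear term contributes at most l (a - m)^2, which [c] absorbs. The rest, (s - ln (1 + s)) /
   2 with s = 2 l sigma^2, is at most s^2 / 4. *)
have : ((2 * l * (a - m)) ^+ 2 * sigma ^+ 2 / (2 * (1 + 2 * l * sigma ^+ 2))
    <= l * (a - m) ^+ 2)%R.
  rewrite ler_pdivrMr; last lra.
  rewrite -subr_ge0 [leRHS](_ : _ = 2 * l * (a - m) ^+ 2)%R; last by lra.
  by apply: mulr_ge0; [lra|exact: sqr_ge0].
lra.
Qed.

(** The opposite of the loss satisfies, for l >= 0, the subgaussian bound around - sigma^2 with
    variance proxy 2 sigma^4. This gives 2 sigma^2 sqrt r, and r >= 0 does the rest. If the risk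
    under [P] is infinite, the left side is -oo. *)
Lemma variance_gap_normal_ge (a r : R) :
  gen_entropy (@quadratic_loss R) P = 'E_P[quadratic_loss a] ->
  KL (distribution P (quadratic_loss a)) (distribution Q (quadratic_loss a))
    = r%:E ->
  'V_Q[idfun] - 'V_P[idfun] <= (2 * sigma ^+ 2 * (Num.sqrt r + r))%:E.
Proof.
move=> HP KLr; have r0 := KL_ge0 KLr.
rewrite variance_normal -(gen_entropy_quadratic P) HP.
have v0 : (0 < sigma ^+ 2)%R by rewrite exprn_gt0.
have [aoo|] := ltP 'E_P[quadratic_loss a] +oo; last first.
  by rewrite leye_eq => /eqP -> /=; rewrite leNye.
have intl : P.-integrable setT (EFin \o quadratic_loss a).
  apply: ge0_integrable_lty; last by move: aoo; rewrite unlock.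
    exact: measurable_funPT.
  by move=> x; exact: sqr_ge0.
have -> : (sigma ^+ 2)%:E - 'E_P[quadratic_loss a] =
    \int[distribution P (quadratic_loss a)]_x (- x)%:E - (- sigma ^+ 2)%:E.
  rewrite -expectationN_distribution; last exact: integrable_add_def.
  by rewrite EFinN oppeK addeC.
apply: le_trans (KL_expectation_gap (b := +oo)
  (phi := fun l => (l ^+ 2 * (2 * sigma ^+ 2 ^+ 2) / 2)%R) _ _ _ KLr) _ => //.
  move=> l l0 _; rewrite integral_distributionE; last first.
    apply: measurableT_comp => //; apply: measurable_funM => //.
    by apply: measurable_funB => //; exact: measurableT_comp.
  by under eq_integral do rewrite opprK; exact: normal_sqloss_mgf.
apply: le_trans (conjugate_inv_quadratic _ _) _.
  by rewrite mulr_ge0// sqr_ge0.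
rewrite lee_fin.
have -> : (2 * (2 * sigma ^+ 2 ^+ 2) * r = (2 * sigma ^+ 2) ^+ 2 * r)%R by lra.
have w0 : (0 < 2 * sigma ^+ 2)%R by rewrite mulr_gt0.
rewrite sqrtrM ?sqr_ge0// sqrtr_sqr gtr0_norm// mulrDr lerDl.
by apply: mulr_ge0 => //; exact: ltW.
Qed.

End normal.

End quadratic_loss.

Theorem theorem4 (R : realType) :
  (forall (d : measure_display) (Z : measurableType d) (A : Type)
     (ell : A -> {mfun Z >-> R}) (P Q : probability Z R) (aP aQ : A)
     (wdP : forall a, expectation_defined P (ell a))
     (wdQ : forall a, expectation_defined Q (ell a))
     (HP : gen_entropy ell P = 'E_P[ell aP])
     (HQ : gen_entropy ell Q = 'E_Q[ell aQ]),
   (* (1) *)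
   ((forall alphaQ betaQ : R,
       (forall z, (alphaQ <= ell aQ z <= betaQ)%R) ->
       gen_entropy ell P - gen_entropy ell Q <=
       (betaQ - alphaQ)%:E *
         dTV (distribution P (ell aQ)) (distribution Q (ell aQ))) /\
    (forall alphaP betaP : R,
       (forall z, (alphaP <= ell aP z <= betaP)%R) ->
       gen_entropy ell Q - gen_entropy ell P <=
       (betaP - alphaP)%:E *
         dTV (distribution P (ell aP)) (distribution Q (ell aP)))) /\
   (* (2) *)
   ((forall sigmaQ : R,
       subgaussian Q (ell aQ) (sigmaQ ^+ 2) ->
       gen_entropy ell P - gen_entropy ell Q <=
       bound_at (fun D => (Num.sqrt (2 * sigmaQ ^+ 2 * D))%:E)
         (KL (distribution P (ell aQ)) (distribution Q (ell aQ)))) /\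
    (forall sigmaP : R,
       subgaussian Q (ell aP) (sigmaP ^+ 2) ->
       gen_entropy ell Q - gen_entropy ell P <=
       bound_at (fun D => (Num.sqrt (2 * sigmaP ^+ 2 * D))%:E)
         (KL (distribution P (ell aP)) (distribution Q (ell aP)))) /\
    (forall (bQ : \bar R) (phiQ : R -> R),
       0 < bQ ->
       Q.-integrable [set: Z] (EFin \o ell aQ) ->
       (forall lambda : R, (0 <= lambda)%R -> lambda%:E < bQ ->
          lne ('M_Q (centered Q (ell aQ)) lambda) <= (phiQ lambda)%:E) ->
       gen_entropy ell P - gen_entropy ell Q <=
       bound_at (conjugate_inv bQ phiQ)
         (KL (distribution P (ell aQ)) (distribution Q (ell aQ)))) /\
    (forall (bP : \bar R) (phiP : R -> R),
       0 < bP ->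
       Q.-integrable [set: Z] (EFin \o ell aP) ->
       (forall lambda : R, (0 <= lambda)%R -> lambda%:E < bP ->
          lne ('M_Q (centered Q (ell aP)) (- lambda)) <= (phiP lambda)%:E) ->
       gen_entropy ell Q - gen_entropy ell P <=
       bound_at (conjugate_inv bP phiP)
         (KL (distribution P (ell aP)) (distribution Q (ell aP))))) /\
   (* (4) *)
   ((ell aQ : Z -> R) \in Lfun Q 2%:E ->
    (ell aP : Z -> R) \in Lfun Q 2%:E ->
    gen_entropy ell P - gen_entropy ell Q <=
      bound_at (fun D => (Num.sqrt (fine 'V_Q[ell aQ] * D))%:E)
        (chi2 (distribution P (ell aQ)) (distribution Q (ell aQ))) /\
    gen_entropy ell Q - gen_entropy ell P <=
      bound_at (fun D => (Num.sqrt (fine 'V_Q[ell aP] * D))%:E)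
        (chi2 (distribution P (ell aP)) (distribution Q (ell aP))))) /\
  (* (3) *)
  (forall (P Q : probability (measurableTypeR R) R) (m sigma : R) (aP aQ : R),
     (0 < sigma)%R ->
     (forall B : set (measurableTypeR R), measurable B ->
        Q B = normal_prob m sigma B) ->
     gen_entropy (@quadratic_loss R) P = 'E_P[quadratic_loss aP] ->
     gen_entropy (@quadratic_loss R) Q = 'E_Q[quadratic_loss aQ] ->
     (gen_entropy (@quadratic_loss R) P = 'V_P[idfun] /\
      gen_entropy (@quadratic_loss R) Q = 'V_Q[idfun] /\
      ((idfun : measurableTypeR R -> R) \in Lfun P 2%:E -> aP%:E = 'E_P[idfun]) /\
      aQ%:E = 'E_Q[idfun]) /\
     'V_P[idfun] - 'V_Q[idfun] <=
       bound_at (fun D => (2 * sigma ^+ 2 * (Num.sqrt D + D))%:E)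
         (KL (distribution P (quadratic_loss aQ))
             (distribution Q (quadratic_loss aQ))) /\
     'V_Q[idfun] - 'V_P[idfun] <=
       bound_at (fun D => (2 * sigma ^+ 2 * (Num.sqrt D + D))%:E)
         (KL (distribution P (quadratic_loss aP))
             (distribution Q (quadratic_loss aP)))).
Proof.
split.
- move=> d Z A ell P Q aP aQ wdP wdQ HP HQ; split; [|split].
  + split=> lo hi; first exact: gen_entropy_le_dTV HQ.
    rewrite dTVC; exact: gen_entropy_le_dTV HP.
  + split; [|split; [|split]].
    * move=> sigma [intQ mgf]; apply: le_bound_at => r KLr.
      apply: le_trans (conjugate_inv_quadratic _ (sqr_ge0 sigma)).
      by apply: gen_entropy_le_KL KLr => // l _ _; exact: mgf.
    * move=> sigma [intQ mgf]; apply: le_bound_at => r KLr.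
      apply: le_trans (conjugate_inv_quadratic _ (sqr_ge0 sigma)).
      apply: gen_entropy_ge_KL KLr => // l _ _.
      by rewrite -[(l ^+ 2)%R]sqrrN; exact: mgf.
    * move=> b phi b0 intQ H; apply: le_bound_at => r.
      apply: gen_entropy_le_KL => // l l0 lb.
      exact/lne_le_expR/H.
    * move=> b phi b0 intQ H; apply: le_bound_at => r.
      apply: gen_entropy_ge_KL => // l l0 lb.
      exact/lne_le_expR/H.
  + move=> L2Q L2P; split; apply: le_bound_at => r.
    * exact: gen_entropy_le_chi2.
    * exact: gen_entropy_ge_chi2.
- move=> P Q m sigma aP aQ sigma0 Qnormal HP HQ.
  (* The Gaussian has finite variance, so [aQ] is forced to be [m], the action for which the upper
     bound is stated. *)
  have EaQ : aQ%:E = 'E_Q[idfun].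
    by apply: quadratic_minimizer HQ; rewrite (variance_normal sigma0 Qnormal) ltry.
  split; first (split; [|split; [|split]]) => //.
  + exact: gen_entropy_quadratic.
  + exact: gen_entropy_quadratic.
  + by move=> /variance_idfun_Lfun2 VP; exact: quadratic_minimizer HP.
  have aQm : aQ = m.
    by move: EaQ; rewrite (expectation_normal sigma0 Qnormal) => -[].
  split; apply: le_bound_at => r.
  + by rewrite aQm; exact: variance_gap_normal_le.
  + exact: (variance_gap_normal_ge sigma0 Qnormal HP).
Qed.
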